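(* Assume that $\mathrm S$ and $\mathbb U$ are compact. Then the transition kernel $$\eta(\cdot\mid\mu^1,\dots,\mu^K;U):=\delta_{\boldsymbol\Phi(\mu^1,\dots,\mu^K;U)}(\cdot)$$ on $\mathcal P(\mathbb X)^K$ given $\mathcal P(\mathbb X)^K\times\mathbb U$ is weak Feller; that is, for every continuous and bounded $g:\mathcal P(\mathbb X)^K\to\mathbb R$, the map $$(\mu^1,\dots,\mu^K;U)\mapsto\int_{\mathcal P(\mathbb X)^K}g\,d\eta(\cdot\mid\mu^1,\dots,\mu^K;U)$$ is continuous on $\mathcal P(\mathbb X)^K\times\mathbb U$.
   Context: Fix integers $N,K,d,d_1,d_2\ge1$ and $\beta>0$. Let $\emptyset\ne\mathrm S\subset\mathbb R^d$, $\mathrm{PE}_N:=\{i/N:i=1,\dots,N\}$, $\mathbb X:=\mathrm{PE}_N\times\mathrm S$. Let $\sigma:\mathbb R^{d_1}\to\mathbb R^{d_1}$ be $1$-Lipschitz. The action space $\mathbb U$ is a nonempty subset of $\mathbb R^{d\times d_1}\times\mathbb R^{d_1\times d}\times\mathbb R^{d_1}\times\mathbb R^{d_2\times d}\times\mathbb R^{d_2\times d}\times\mathbb R^{d\times d}$ with the Euclidean (product Frobenius) norm; its elements are written $U=(\mathsf W,\mathsf A,\mathsf b,\mathsf Q,\mathsf K,\mathsf V)$. $\mathcal P(\mathbb X)$ denotes the Borel probability measures on $\mathbb X$ with the topology of weak convergence (convergence against bounded continuous functions), and $\mathcal P(\mathbb X)^K$ carries the product topology. For $\mu\in\mathcal P(\mathbb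 X)$, $\mu_{\mathrm S}$ is its marginal on $\mathrm S$. Define $f:\mathbb X\times\mathbb U\times\mathcal P(\mathbb X)\to\mathbb X$ by $$f((p,x),U,\mu):=\Big(p,\ \mathsf W\sigma(\mathsf Ax+\mathsf b)+\frac{\int_{\mathrm S}e^{\beta\langle\mathsf Qx,\mathsf Kz\rangle}\mathsf Vz\,\mu_{\mathrm S}(dz)}{\int_{\mathrm S}e^{\beta\langle\mathsf Qx,\mathsf Kz\rangle}\mu_{\mathrm S}(dz)}\Big);$$ it is a standing convention that $f$ is $\mathbb X$-valued. Let $\Phi(\mu,U):=\mu\circ f(\cdot,U,\mu)^{-1}$ (push-forward of $\mu$) and $\boldsymbol\Phi(\mu^1,\dots,\mu^K;U):=(\Phi(\mu^1,U),\dots,\Phi(\mu^K,U))$. *)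

(* Defs.v *)
From HB Require Import structures.
From mathcomp Require Import all_boot all_order all_algebra.
From mathcomp Require Import all_classical all_reals all_analysis.
From mathcomp Require Import measurable_realfun.

Set Implicit Arguments.
Unset Strict Implicit.
Unset Printing Implicit Defensive.

Import Order.TTheory GRing.Theory Num.Theory.
Import numFieldNormedType.Exports.

Local Open Scope classical_set_scope.
Local Open Scope ring_scope.

(* The library declares the topology and the base point of a product
   separately, but not their join. *)
HB.instance Definition _ (T U : ptopologicalType) := Pointed.on (T * U)%type.

(* A nonempty set seen as a type, with the subspace topology. The proof of
   nonemptiness only serves to provide the base point that measurable types
   require. *)
Definition nonempty_type (T : Type) (A : set T) (A0 : A !=set0) : Type :=
  set_type A.

HB.instance Definition _ (T : choiceType) (A : set T) (A0 : A !=set0) :=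
  Choice.copy (nonempty_type A0) (set_type A).

HB.instance Definition _ (T : topologicalType) (A : set T) (A0 : A !=set0) :=
  Topological.copy (nonempty_type A0) (set_type A).

HB.instance Definition _ (T : choiceType) (A : set T) (A0 : A !=set0) :=
  isPointed.Build (nonempty_type A0)
    (SigSub (mem_set (projT2 (cid A0))) : set_type A).

HB.instance Definition _ (T : topologicalType) (A : set T) (A0 : A !=set0) :=
  Pointed.on (nonempty_type A0).

Definition pt (T : Type) (A : set T) (A0 : A !=set0) (x : nonempty_type A0) :
  T := \val (x : set_type A).

Definition mk_pt (T : Type) (A : set T) (A0 : A !=set0) (x : T) (Ax : A x) :
  nonempty_type A0 := (SigSub (mem_set Ax) : set_type A).

Lemma ptP (T : Type) (A : set T) (A0 : A !=set0) (x : nonempty_type A0) :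
  A (pt x).
Proof. exact/set_mem/(valP (x : set_type A)). Qed.

Lemma pt_continuous (T : topologicalType) (A : set T) (A0 : A !=set0) :
  continuous (@pt T A A0).
Proof. exact: (@initial_continuous (set_type A) T set_val). Qed.

Definition borel (T : ptopologicalType) := g_sigma_algebraType (@open T).

Lemma continuous_borel (T U : ptopologicalType) (f : T -> U) :
  continuous f -> measurable_fun [set: borel T] (f : borel T -> borel U).
Proof.
move=> /continuousP cf; apply: (@measurability _ _ (borel T) (borel U) _ _ open) => //.
move=> _ [B oB <-]; rewrite setTI; apply: sub_sigma_algebra; exact: cf.
Qed.

Section borel_probability.
Variables (R : realType) (T : ptopologicalType).

Definition bprob := probability (borel T) R.

Definition bounded_continuous :=
  {g : T -> R | continuous g /\ bounded_fun g}.

Definition test (mu : bprob) :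
    prod_topology (fun _ : bounded_continuous => R : topologicalType) :=
  fun g => \int[mu]_x sval g x.

HB.instance Definition _ := Pointed.copy bprob (probability (borel T) R).

(* The topology of weak convergence: the coarsest topology that makes
   mu |-> \int g dmu continuous for every bounded continuous g. *)
HB.instance Definition _ := Topological.copy bprob (initial_topology test).

End borel_probability.

Definition bpush (R : realType) (T U : ptopologicalType) (f : T -> U)
    (mf : measurable_fun [set: borel T] (f : borel T -> borel U))
    (mu : bprob R T) : bprob R U :=
  distribution mu (mfun_Sub (mem_set mf)).

Lemma bpushE (R : realType) (T U : ptopologicalType) (f : T -> U)
    (mf : measurable_fun [set: borel T] (f : borel T -> borel U))
    (mu : bprob R T) (A : set U) :
  bpush mf mu A = mu (f @^-1` A).
Proof. by []. Qed.

Definition power (K : nat) (T : Type) : Type :=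
  prod_topology (fun _ : 'I_K => T).

HB.instance Definition _ (K : nat) (T : ptopologicalType) :=
  Topological.copy (power K T) (prod_topology (fun _ : 'I_K => T)).
HB.instance Definition _ (K : nat) (T : ptopologicalType) :=
  isPointed.Build (power K T) (fun _ : 'I_K => point).

Section weak_feller.
Variables (R : realType) (Z Y : ptopologicalType).

Definition weak_feller (k : R.-pker (borel Z) ~> (borel Y)) :=
  forall g : Y -> R, continuous g -> bounded_fun g ->
    continuous (fun z : Z => \int[k z]_y g y).

End weak_feller.

Section euclidean.
Variables (R : realType) (n : nat).

Definition dot (u v : 'cV[R]_n) : R := \sum_i u i 0 * v i 0.

(* The library's norm on matrices is the sup norm. *)
Definition enorm (u : 'cV[R]_n) : R := Num.sqrt (dot u u).

Lemma enorm_coord (u : 'cV[R]_n) i : `|u i 0| <= enorm u.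
Proof.
rewrite -sqrtr_sqr ler_wsqrtr// /dot (bigD1 i)//= expr2 lerDl.
by apply: sumr_ge0 => j _; rewrite -expr2 sqr_ge0.
Qed.

Lemma enorm_le (u : 'cV[R]_n) (e : R) :
  (forall i, `|u i 0| <= e) -> enorm u <= n%:R * e.
Proof.
move=> ue; have [e0|e0] := leP 0 e; last first.
  rewrite /enorm /dot big1 ?sqrtr0; last first.
    by move=> i; have := le_lt_trans (ue i) e0; rewrite normr_lt0.
  case: n u ue => [|m] u ue; first by rewrite mul0r.
  by have := le_lt_trans (ue ord0) e0; rewrite normr_lt0.
rewrite -(ger0_norm (_ : 0 <= n%:R * e)) ?mulr_ge0// -sqrtr_sqr.
rewrite ler_wsqrtr// exprMn.
apply: (@le_trans _ _ (\sum_(i < n) e ^+ 2)).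
  by apply: ler_sum => i _; rewrite -expr2 -real_normK ?num_real// lerXn2r.
rewrite sumr_const card_ord -[leLHS]mulr_natl; apply: ler_wpM2r; rewrite ?sqr_ge0//.
by rewrite -natrX ler_nat; case: (n) => // m; rewrite expnS leq_pmulr.
Qed.

End euclidean.

(* Borel measurability of a vector-valued map from that of its coordinates. *)
Section coordinates.
Variables (R : realType) (disp : measure_display) (T : measurableType disp).
Variables (n : nat) (G : T -> 'cV[R]_n).
Hypothesis mG : forall i, measurable_fun [set: T] (fun t => G t i 0).

Lemma measurable_preimage_open (O : set 'cV[R]_n) : open O ->
  measurable (G @^-1` O).
Proof.
move=> oO.
pose B (qk : 'cV[rat]_n * nat) : set 'cV[R]_n :=
  [set v | forall i, `|ratr (qk.1 i 0) - v i 0| < qk.2.+1%:R^-1].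
pose F qk : set T := if `[< B qk `<=` O >] then G @^-1` (B qk) else set0.
have -> : G @^-1` O = \bigcup_qk F qk.
  apply/seteqP; split => [t /= Ot|t [qk _]]; last first.
    by rewrite /F; case: asboolP => // BO /BO.
  have /nbhs_ballP[e /= e0 eO] : nbhs (G t) O by exact: open_nbhs_nbhs.
  pose k := Num.truncn (2 / e); have ke : k.+1%:R^-1 < e / 2.
    by rewrite -[ltRHS]invrK ltf_pV2 ?posrE ?invr_gt0 ?divr_gt0// invf_div truncnS_gt.
  have k0 : 0 < k.+1%:R^-1 :> R by rewrite invr_gt0.
  have hq i : exists q : rat, `|ratr q - G t i 0| < k.+1%:R^-1.
    have [q] := @rat_in_itvoo R (G t i 0 - k.+1%:R^-1) (G t i 0 + k.+1%:R^-1)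
      ltac:(by rewrite ltrD2l (lt_trans _ k0)// oppr_lt0).
    by rewrite in_itv/= => /andP[q1 q2]; exists q; rewrite ltr_distl q1 q2.
  have [q qP] := choice hq.
  exists (\col_i q i, k) => //; rewrite /F ifT.
    by move=> i /=; rewrite mxE.
  apply/asboolP => v Bv; apply: eO; split => // i j; rewrite ord1.
  rewrite -ball_normE /=; apply: le_lt_trans (ler_distD (ratr (q i)) _ _) _.
  rewrite (splitr e) ltrD//; first by rewrite distrC (lt_trans (qP i)).
  by have := Bv i; rewrite /= mxE => /lt_trans; apply.
apply: countable_bigcupT_measurable => [|qk]; first exact: countableP.
rewrite /F; case: ifP => // _.
have -> : G @^-1` B qk = \bigcap_(i in [set: 'I_n])
    ((fun t => `|ratr (qk.1 i 0) - G t i 0|) @^-1` `]-oo, qk.2.+1%:R^-1[).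
  apply/seteqP; split => [t /= Bt i _|t Bt i] /=.
    by rewrite in_itv/=; exact: Bt.
  by have := Bt i I; rewrite /= in_itv.
apply: fin_bigcap_measurable => [|i _]; first exact: finite_finset.
rewrite -[X in measurable X]setTI.
have : measurable_fun [set: T] (fun t => `|ratr (qk.1 i 0) - G t i 0|).
  apply: measurableT_comp => //; apply: measurable_funB => //.
by apply.
Qed.

End coordinates.

Lemma measurable_Rintegral (R : realType) (disp1 disp2 : measure_display)
    (T1 : measurableType disp1) (T2 : measurableType disp2)
    (nu : probability T2 R) (h : T1 * T2 -> R) :
  measurable_fun [set: T1 * T2] h ->
  measurable_fun [set: T1] (fun x => \int[nu]_z h (x, z)).
Proof.
move=> /measurable_EFinP mh; apply: measurableT_comp; first exact: fine_measurable.
under eq_fun do rewrite integralE.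
apply: emeasurable_funB.
- have := measurable_fun_fubini_tonelli_F (m2 := nu) _ (measurable_funepos mh).
  move=> /(_ (fun=> funepos_ge0 _ _)); congr measurable_fun; apply/funext => x.
  by apply: eq_integral => z _; rewrite !funeposE.
- have := measurable_fun_fubini_tonelli_F (m2 := nu) _ (measurable_funeneg mh).
  move=> /(_ (fun=> funeneg_ge0 _ _)); congr measurable_fun; apply/funext => x.
  by apply: eq_integral => z _; rewrite !funenegE.
Qed.

Section model.
Variables (R : realType) (N d d1 d2 : nat) (beta : R).

(* Tuples (W, A, b, Q, K, V). The product topology on matrices is the one of
   the Euclidean norm, and nothing else depends on the choice of a norm. *)
Definition action : Type :=
  ('M[R]_(d, d1) * 'M[R]_(d1, d) * 'cV[R]_d1 * 'M[R]_(d2, d) * 'M[R]_(d2, d)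
   * 'M[R]_d)%type.

Definition PE : set R :=
  [set p | exists2 i : nat, (1 <= i <= N)%N & p = i%:R / N%:R].

Lemma PE_nonempty : (0 < N)%N -> PE !=set0.
Proof. by move=> N0; exists (1 / N%:R); exists 1%N. Qed.

Definition lipschitz1 (sigma : 'cV[R]_d1 -> 'cV[R]_d1) :=
  forall x y, enorm (sigma x - sigma y) <= enorm (x - y).

Section dynamics.
Variables (N0 : (0 < N)%N) (S : set 'cV[R]_d) (S0 : S !=set0).
Variables (UU : set action) (UU0 : UU !=set0).

Definition state : Type :=
  (nonempty_type (PE_nonempty N0) * nonempty_type S0)%type.

Lemma measurable_snd_state :
  measurable_fun [set: borel state] (snd : borel state -> borel (nonempty_type S0)).
Proof. by apply: continuous_borel => x; exact: cvg_snd. Qed.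


Definition marginal (mu : bprob R state) : bprob R (nonempty_type S0) :=
  bpush measurable_snd_state mu.

Local Notation ptS := (@pt _ S S0).

Definition weight (Q Ky : 'M[R]_(d2, d)) (x z : 'cV[R]_d) : R :=
  expR (beta * dot (Q *m x) (Ky *m z)).

(* The vector-valued integral in the numerator is taken coordinatewise. *)
Definition attention (Q Ky : 'M[R]_(d2, d)) (V : 'M[R]_d)
    (nu : bprob R (nonempty_type S0)) (x : 'cV[R]_d) : 'cV[R]_d :=
  (\int[nu]_z weight Q Ky x (ptS z))^-1 *:
  \col_i \int[nu]_z (weight Q Ky x (ptS z) * (V *m ptS z) i 0).

Variable sigma : 'cV[R]_d1 -> 'cV[R]_d1.

Definition step (U : action) (nu : bprob R (nonempty_type S0))
    (x : 'cV[R]_d) : 'cV[R]_d :=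
  let: (W, A, b, Q, Ky, V) := U in
  W *m sigma (A *m x + b) + attention Q Ky V nu x.

(* The standing convention that the dynamics stay in S. *)
Definition state_valued : Prop :=
  forall (x : state) (U : nonempty_type UU0) (mu : bprob R state),
    S (step (pt U) (marginal mu) (pt x.2)).

Hypothesis sv : state_valued.

Definition transition (x : state) (U : nonempty_type UU0) (mu : bprob R state) : state :=
  (x.1, mk_pt S0 (sv x U mu)).

Let T := borel (nonempty_type S0).

Let measurable_coord i : measurable_fun [set: T] (fun z : T => ptS z i 0).
Proof.
apply: (@measurability _ _ T R _ _ _ (RGenOpens.measurableE R)).
move=> _ [_ [a [b ->]] <-]; rewrite setTI; apply: sub_sigma_algebra.
have : continuous (fun z : nonempty_type S0 => ptS z i 0).
  move=> z; apply: (@continuous_comp _ _ _ (ptS) (fun v : 'cV_d => v i 0)).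
    exact: pt_continuous.
  exact: coord_continuous.
by move/continuousP; apply; exact: interval_open.
Qed.

Let measurable_mulmx_coord disp (X : measurableType disp) (h : X -> T) m
    (M : 'M[R]_(m, d)) i :
  measurable_fun [set: X] h ->
  measurable_fun [set: X] (fun z => (M *m ptS (h z)) i 0).
Proof.
move=> mh; under eq_fun do rewrite mxE; apply: measurable_sum => j.
apply: measurable_funM => //.
exact: (measurableT_comp (measurable_coord j) mh).
Qed.

Let measurable_weight Q Ky :
  measurable_fun [set: T * T] (fun xz => weight Q Ky (ptS xz.1) (ptS xz.2)).
Proof.
apply: measurableT_comp => //; apply: measurable_funM => //.
apply: measurable_sum => i; apply: measurable_funM;
  apply: measurable_mulmx_coord; [exact: measurable_fst|exact: measurable_snd].
Qed.

Hypothesis sigmaL : lipschitz1 sigma.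

Lemma lipschitz1_continuous : continuous sigma.
Proof.
move=> x O /nbhs_ballP[e /= e0 eO]; apply/nbhs_ballP.
have e'0 : 0 < e / d1.+1%:R by rewrite divr_gt0.
exists (e / d1.+1%:R) => //= y [_ xy]; apply: eO; split => // i j.
have lt_e : enorm (sigma x - sigma y) < e.
  apply: le_lt_trans (sigmaL x y) _.
  apply: (@le_lt_trans _ _ (d1%:R * (e / d1.+1%:R))).
    apply: enorm_le => k.
    by have := xy k 0; rewrite -ball_normE /= !mxE => /ltW.
  by rewrite mulrCA gtr_pMr// ltr_pdivrMr// mul1r ltr_nat.
rewrite ord1 -ball_normE /=.
by have := enorm_coord (sigma x - sigma y) i; rewrite !mxE => /le_lt_trans; apply.
Qed.

Let measurable_step (U : action) (nu : bprob R (nonempty_type S0)) i :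
  measurable_fun [set: T] (fun x : T => step U nu (ptS x) i 0).
Proof.
case: U => [[[[[W A] b] Q] Ky] V]; rewrite /step/=.
under eq_fun do rewrite !mxE.
apply: measurable_funD.
  apply: measurable_sum => j; apply: measurable_funM => //.
  apply: (@measurability _ _ T R _ _ _ (RGenOpens.measurableE R)).
  move=> _ [_ [a [c ->]] <-]; rewrite setTI.
  apply: (@measurable_preimage_open _ _ _ _ (fun x : T => A *m ptS x + b) _
    ((fun v => sigma v j 0) @^-1` `]a, c[)).
    move=> k; under eq_fun do rewrite mxE.
    by apply: measurable_funD => //; exact: measurable_mulmx_coord.
  have : continuous (fun v => sigma v j 0).
    move=> v; apply: (@continuous_comp _ _ _ sigma (fun v : 'cV_d1 => v j 0)).
      exact: lipschitz1_continuous.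
    exact: coord_continuous.
  by move/continuousP; apply; exact: interval_open.
have w0 x : 0 <= \int[nu]_z weight Q Ky (ptS x) (ptS z).
  by apply: Rintegral_ge0 => z _; exact: expR_ge0.
apply: measurable_funM.
  under eq_fun do rewrite -powR_inv1//.
  apply: (measurableT_comp (measurable_powR (-1))).
  exact: (@measurable_Rintegral _ _ _ T T nu _ (measurable_weight Q Ky)).
apply: (@measurable_Rintegral _ _ _ T T nu
  (fun xz => weight Q Ky (ptS xz.1) (ptS xz.2) * (V *m ptS xz.2) i 0)).
apply: measurable_funM; first exact: measurable_weight.
by apply: measurable_mulmx_coord; exact: measurable_snd.
Qed.

Lemma measurable_transition (U : nonempty_type UU0) (mu : bprob R state) :
  measurable_fun [set: borel state] (fun x => transition x U mu : borel state).
Proof.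
apply: (@measurability _ _ (borel state) (borel state) _ _ open) => //.
move=> _ [B oB <-]; rewrite setTI.
pose g (z : T) := step (pt U) (marginal mu) (ptS z).
pose D (i : nat) : set (borel state) := [set x | pt x.1 = i%:R / N%:R].
pose E (i : nat) : set T := [set z | exists (p : nonempty_type (PE_nonempty N0))
  (s : nonempty_type S0), [/\ pt p = i%:R / N%:R, pt s = g z & B (p, s)]].
have -> : (fun x => transition x U mu) @^-1` B = \bigcup_i (D i `&` snd @^-1` E i).
  apply/seteqP; split => [x Bx|x [i _ [Dx [p [s [pi sx Bps]]]]]] /=.
    have [i _ xi] := ptP x.1.
    by exists i => //; split => //; exists x.1, (transition x U mu).2; split.
  have px : p = x.1 by apply: val_inj; rewrite [LHS]pi [RHS]Dx.
  suff -> : transition x U mu = (p, s) by [].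
  by rewrite /transition px; congr pair; apply: val_inj; exact/esym.
apply: bigcupT_measurable => i; apply: measurableI.
  rewrite -[D i]setCK; apply: measurableC; apply: sub_sigma_algebra.
  have : continuous (fun x : state => pt x.1).
    move=> x; apply: (@continuous_comp _ _ _ fst (@pt _ _ (PE_nonempty N0))).
      exact: cvg_fst.
    exact: pt_continuous.
  move=> /continuousP /(_ (~` [set i%:R / N%:R])); apply.
  by apply: closed_openC; exact: closed_eq.
rewrite -[X in measurable X]setTI; apply: measurable_snd_state => //.
have [iPE|iPE] := pselect (PE (i%:R / N%:R)); last first.
  rewrite (_ : E i = set0)//; apply/seteqP; split => // z [p [s [pi _ _]]].
  by apply: iPE; rewrite -pi; exact: ptP.
pose p : nonempty_type (PE_nonempty N0) := mk_pt _ iPE.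
have : open [set s : nonempty_type S0 | B (p, s)].
  have : continuous (fun s : nonempty_type S0 => (p, s) : state).
    move=> s A [[P Q] [/= nP nQ] PQA]; apply: filterS nQ => t Qt.
    by apply: PQA; split => //=; exact: (nbhs_singleton nP).
  by move/continuousP; apply.
case=> O oO OB.
have gS z : S (g z) by exact: (sv (point, z) U mu).
have -> : E i = g @^-1` O.
  apply/seteqP; split => [z [q [s [qi sz Bqs]]]|z Oz] /=.
    have qp : q = p by apply: val_inj; exact: qi.
    move: Bqs; rewrite qp => Bps.
    have Os : (set_val @^-1` O) s by rewrite OB.
    by rewrite -sz; exact: Os.
  exists p, (mk_pt S0 (gS z)); split => //.
  by have : (set_val @^-1` O) (mk_pt S0 (gS z)); [exact: Oz|rewrite OB].
by apply: measurable_preimage_open => // j; exact: measurable_step.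
Qed.

Definition Phi (mu : bprob R state) (U : nonempty_type UU0) : bprob R state :=
  bpush (measurable_transition U mu) mu.

Variable K : nat.

Let profile := power K (bprob R state).

Definition bPhi (muU : profile * nonempty_type UU0) : profile :=
  fun k : 'I_K => Phi (muU.1 k) muU.2.

(* The kernel of Dirac masses at the values of bPhi; measurability of bPhi is
   what makes it a transition kernel. *)
Definition eta_kernel (mbPhi : measurable_fun [set: borel (profile * nonempty_type UU0)%type]
      (bPhi : borel (profile * nonempty_type UU0)%type -> borel profile)) :
    R.-pker (borel (profile * nonempty_type UU0)%type) ~> (borel profile) :=
  kdirac mbPhi.

End dynamics.
End model.

Arguments eta_kernel {R N d d1 d2 beta N0 S S0 UU UU0 sigma} sv sigmaL K mbPhi.

(* Main.v *)
(* A measure-valued map into the weak topology is continuous as soon as its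
   integrals against bounded continuous functions are. If the underlying space
   is compact, a jointly continuous integrand h(z, x) is uniformly close in x to
   h(z0, x) for z near z0, so z |-> \int h(z, x) m_z(dx) is continuous whenever
   z |-> m_z is weakly continuous. Applied to the numerator and the denominator
   of the attention term (whose denominator is positive) this yields the joint
   continuity of the transition map; applied to a bounded continuous function
   composed with the transition map it yields the continuity of bPhi, and
   integrating g against a Dirac mass at bPhi z gives g (bPhi z). *)

Require Import Defs.
From HB Require Import structures.
From mathcomp Require Import all_boot all_order all_algebra.
From mathcomp Require Import all_classical all_reals all_analysis.
From mathcomp Require Import measurable_realfun.

Set Implicit Arguments.
Unset Strict Implicit.
Unset Printing Implicit Defensive.

Import Order.TTheory GRing.Theory Num.Theory.
Import numFieldNormedType.Exports.

Local Open Scope classical_set_scope.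
Local Open Scope ring_scope.

(** * Boundedness, product topologies and Borel measurability *)

Lemma compact_continuous_bounded (R : realType) (T : topologicalType)
    (f : T -> R) :
  compact [set: T] -> continuous f -> bounded_fun f.
Proof.
move=> cT cf.
have /compact_bounded [M [Mreal MP]] : compact (f @` [set: T]).
  by apply: continuous_compact => //; exact: continuous_subspaceT.
exists M; split => // y /MP fM x _ /=; apply: fM; exact: imageP.
Qed.

(** The product topology is the supremum of the initial topologies of the projections, so
    convergence in it implies convergence in each of them. *)
Lemma prod_topology_proj_continuous (I : Type) (T : I -> topologicalType) i :
  continuous (fun f : prod_topology T => f i).
Proof.
move=> f A nA.
pose TS i :=
  Topological.class (initial_topology (fun f : (forall i, T i) => f i)).
have /(@cvg_sup _ _ TS)/(_ i) :
  f @[f --> (f : prod_topology T)] --> (f : prod_topology T) by exact: cvg_id.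
move=> /(_ (@nbhs_filter (prod_topology T) f)) H.
apply: (H (fun f => A (f i))).
exact: (@initial_continuous _ _ (fun f : (forall i, T i) => f i) f _ nA).
Qed.

Lemma prod_topology_continuous (Z : topologicalType) (I : Type)
    (T : I -> topologicalType) (f : Z -> prod_topology T) :
  (forall i, continuous (fun z => f z i)) -> continuous f.
Proof.
move=> cf z; apply/cvg_sup => i.
exact: (@continuous_comp_initial _ _ _ (fun f : (forall i, T i) => f i)
  f (cf i)).
Qed.

Lemma continuous_borel_real (R : realType) (T : ptopologicalType) (f : T -> R) :
  continuous f -> measurable_fun [set: borel T] f.
Proof.
move=> /continuousP cf.
apply: (@measurability _ _ (borel T) R _ _ _ (RGenOpens.measurableE R)).
move=> _ [_ [a [b ->]] <-]; rewrite setTI; apply: sub_sigma_algebra.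
by apply: cf; exact: interval_open.
Qed.

Lemma Rintegral_probability_cst (R : realType) disp (T : measurableType disp)
    (mu : probability T R) (r : R) : \int[mu]_x r = r.
Proof.
rewrite Rintegral_cst// [X in fine X](_ : _ = 1%E) ?mulr1//.
exact: probability_setT.
Qed.

(** * Integrals against weakly varying probability measures *)

Section compact_integral.
Variables (R : realType) (T : ptopologicalType).

Lemma bounded_continuous_integrable (mu : bprob R T) (f : T -> R) :
  continuous f -> bounded_fun f -> mu.-integrable [set: borel T] (EFin \o f).
Proof.
move=> cf bf; apply: measurable_bounded_integrable => //.
- by rewrite (le_lt_trans (probability_le1 _ _)) ?ltry.
- exact: continuous_borel_real.
Qed.

(** The integral factors as [test], continuous because it defines the weak topology, followed by
    evaluation at the coordinate [g]. *)
Lemma integral_continuous_test (f : T -> R) :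
  continuous f -> bounded_fun f ->
  continuous (fun mu : bprob R T => \int[mu]_x f x).
Proof.
move=> cf bf.
pose g : bounded_continuous R T := exist _ f (conj cf bf).
move=> mu.
apply: (@continuous_comp _ _ _ (@test R T : bprob R T -> _)
  (fun k : prod_topology
    (fun _ : bounded_continuous R T => R : topologicalType) => k g)).
  exact: (@initial_continuous (bprob R T) _ (@test R T)).
exact: prod_topology_proj_continuous.
Qed.

Lemma continuous_bprob (Z : topologicalType) (m : Z -> bprob R T) :
  (forall f : T -> R, continuous f -> bounded_fun f ->
    continuous (fun z => \int[m z]_x f x)) -> continuous m.
Proof.
move=> mf; apply: (@continuous_comp_initial _ _ _ (@test R T)).
apply: prod_topology_continuous => g.
exact: (mf (sval g) (svalP g).1 (svalP g).2).
Qed.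

Hypothesis cT : compact [set: T].

Lemma continuous_Rintegral (Z : topologicalType) (m : Z -> bprob R T)
    (h : Z -> T -> R) :
  continuous m -> continuous (fun zx : Z * T => h zx.1 zx.2) ->
  continuous (fun z => \int[m z]_x h z x).
Proof.
move=> cm ch z0.
have chz z : continuous (h z).
  move=> x; apply: (@continuous_comp _ _ _ (fun x => (z, x))
    (fun zx : Z * T => h zx.1 zx.2)); last exact: ch.
  by apply: cvg_pair; [exact: cvg_cst|exact: cvg_id].
have bh z : bounded_fun (h z) by exact: compact_continuous_bounded.
have ih z z' : (m z).-integrable [set: borel T] (EFin \o h z').
  exact: bounded_continuous_integrable.
apply/cvgrPdist_lt => e e0.
have e2 : 0 < e / 2 by rewrite divr_gt0.
have unif : \forall z \near z0, forall x, `|h z0 x - h z x| < e / 2.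
  suff : \forall z \near z0,
      [set: T] `<=` (fun x => `|h z0 x - h z x| < e / 2).
    by apply: filterS => z zx x; exact: zx.
  (* Compactness in near-covering form exchanges the quantifiers: it suffices to treat points near
     each [x], with a neighbourhood of [z0] depending on [x]. *)
  move/compact_near_coveringP: cT; apply => x _.
  (* A quarter of [e], because [h z0 y] and [h z y] are both compared with [h z0 x]. *)
  have e4 : 0 < e / 2 / 2 by rewrite divr_gt0.
  have /cvgrPdist_lt/(_ _ e4) [[A B] /= [A0 Bx] AB] := ch (z0, x).
  exists (B, A) => //= -[y z] [/= By Az].
  have /= h1 := AB (z, y) (conj Az By).
  have /= h2 := AB (z0, y) (conj (nbhs_singleton A0) By).
  rewrite (splitr (e / 2)) -(subrKA (h z0 x)).
  by rewrite (le_lt_trans (ler_normD _ _))// ltrD// distrC.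
have /cvgrPdist_lt/(_ _ e2) weak :=
  @integral_continuous_test _ (chz z0) (bh z0) (m z0).
near=> z.
(* The pivot changes the measure first, with the integrand frozen at [z0], and the integrand second.
   Weak convergence bounds the first term strictly; uniform closeness bounds the second by [e / 2],
   since [m z] has mass one. *)
rewrite (splitr e) -(subrKA (\int[m z]_x h z0 x)).
rewrite (le_lt_trans (ler_normD _ _))// ltr_leD//.
  by near: z; exact: (cm z0 _ weak).
rewrite -RintegralB; [|by []|exact: ih..].
have cd : continuous (fun x => h z0 x - h z x).
  by move=> x; apply: cvgB; exact: chz.
have bd : bounded_fun (fun x => h z0 x - h z x).
  exact: compact_continuous_bounded.
have id := bounded_continuous_integrable (m z) cd bd.
apply: le_trans (le_normr_Rintegral _ id) _ => //.
rewrite -[leRHS](Rintegral_probability_cst (m z)).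
apply: le_Rintegral => //.
- exact: (integrable_norm id).
- exact: (finite_measure_integrable_cst _ (e / 2)).
- by move=> x _; apply: ltW; move: x; near: z.
Unshelve. all: by end_near. Qed.
End compact_integral.

(** * Continuity of matrix operations and of the exponential weight *)

Section continuity.
Variables (R : realType) (Z : topologicalType).

Lemma continuous_matrix m n (f : Z -> 'M[R]_(m, n)) :
  (forall i j, continuous (fun z => f z i j)) -> continuous f.
Proof.
move=> cf z; apply/cvg_ballP => e e0.
have : \forall z' \near z, forall ij : 'I_m * 'I_n,
    ball (f z ij.1 ij.2) e (f z' ij.1 ij.2).
  (* There are finitely many entries, so their neighbourhoods intersect in a single one. *)
  by apply: filter_forall => ij; move/cvg_ballP: (cf ij.1 ij.2 z); apply.
by apply: filterS => z' zz'; split => // i j; exact: (zz' (i, j)).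
Qed.

Lemma continuous_entry m n (f : Z -> 'M[R]_(m, n)) i j :
  continuous f -> continuous (fun z => f z i j).
Proof.
move=> cf z; apply: (@continuous_comp _ _ _ f (fun M : 'M[R]_(m, n) => M i j)).
  exact: cf.
exact: coord_continuous.
Qed.

Lemma continuous_sumr n (f : 'I_n -> Z -> R) :
  (forall i, continuous (f i)) -> continuous (fun z => \sum_i f i z).
Proof.
move=> cf; apply: continuous_big => //.
exact: add_continuous.
Qed.

Lemma continuousMr (f g : Z -> R) :
  continuous f -> continuous g -> continuous (fun z => f z * g z).
Proof. by move=> cf cg z; apply: cvgM; [exact: cf|exact: cg]. Qed.

Lemma continuous_addmx m n (f g : Z -> 'M[R]_(m, n)) :
  continuous f -> continuous g -> continuous (fun z => f z + g z).
Proof. by move=> cf cg z; apply: cvgD; [exact: cf|exact: cg]. Qed.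

Lemma continuous_mulmx m n p (f : Z -> 'M[R]_(m, n)) (g : Z -> 'M[R]_(n, p)) :
  continuous f -> continuous g -> continuous (fun z => f z *m g z).
Proof.
move=> cf cg; apply: continuous_matrix => i j.
rewrite [X in continuous X](_ : _ = fun z => \sum_k f z i k * g z k j).
  by apply: continuous_sumr => k; apply: continuousMr; exact: continuous_entry.
by apply/funext => z; rewrite mxE.
Qed.

Lemma continuous_dot n (f g : Z -> 'cV[R]_n) :
  continuous f -> continuous g -> continuous (fun z => dot (f z) (g z)).
Proof.
move=> cf cg; apply: continuous_sumr => i.
by apply: continuousMr; exact: continuous_entry.
Qed.

Lemma continuous_weight d d2 beta (Q Ky : Z -> 'M[R]_(d2, d))
    (x y : Z -> 'cV[R]_d) :
  continuous Q -> continuous Ky -> continuous x -> continuous y ->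
  continuous (fun z => weight beta (Q z) (Ky z) (x z) (y z)).
Proof.
move=> cQ cK cx cy z.
apply: (@continuous_comp _ _ _
  (fun z => beta * dot (Q z *m x z) (Ky z *m y z)) (@expR R)).
  apply: continuousMr; first exact: cst_continuous.
  by apply: continuous_dot; exact: continuous_mulmx.
exact: continuous_expR.
Qed.
End continuity.

(** * Composition, compact subspaces and change of variables *)

Lemma continuous_pair (Z T U : topologicalType) (f : Z -> T) (g : Z -> U) :
  continuous f -> continuous g -> continuous (fun z => (f z, g z)).
Proof. by move=> cf cg z; apply: cvg_pair; [exact: cf|exact: cg]. Qed.

Lemma continuous_compose (Z T U : topologicalType) (f : Z -> T) (g : T -> U) :
  continuous f -> continuous g -> continuous (fun z => g (f z)).
Proof.
by move=> cf cg z; apply: (@continuous_comp _ _ _ f g); [exact: cf|exact: cg].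
Qed.

Lemma continuous_fst (T U : topologicalType) : continuous (@fst T U).
Proof. by move=> x; exact: cvg_fst. Qed.

Lemma continuous_snd (T U : topologicalType) : continuous (@snd T U).
Proof. by move=> x; exact: cvg_snd. Qed.

Lemma continuous_mk_pt (Z T : topologicalType) (A : set T) (A0 : A !=set0)
    (f : Z -> T) (fA : forall z, A (f z)) :
  continuous f -> continuous (fun z => mk_pt A0 (fA z)).
Proof.
move=> cf.
exact: (@continuous_comp_initial _ _ _ (set_val : set_type A -> T)).
Qed.

Lemma compact_nonempty_type (T : topologicalType) (A : set T) (A0 : A !=set0) :
  compact A -> compact [set: nonempty_type A0].
Proof.
rewrite !compact_near_coveringP => cA I F P FF cover.
(* Quantifying over the membership proof turns [P] into a predicate on the ambient space, where
   compactness of [A] applies; proof irrelevance brings it back to the subtype. *)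
suff : \near F, A `<=` (fun x => forall Ax : A x, P F (mk_pt A0 Ax)).
  apply: filterS => i AP x _.
  by have := AP _ (ptP x) (ptP x); congr P; exact: val_inj.
apply: cA => x Ax.
have [[B C] /= [[D [[E oE ED] Dx] DB] FC] BC] := cover (mk_pt A0 Ax) Logic.I.
exists (E, C); first split => //=.
  apply: open_nbhs_nbhs; split => //.
  by move: Dx; rewrite -ED.
move=> [y i] [/= Ey Ci] Ay; apply: (BC (mk_pt A0 Ay, i)); split => //=.
by apply: DB; rewrite -ED.
Qed.

Lemma compact_PE (R : realType) N : compact (@PE R N).
Proof.
apply: finite_compact.
apply: (@sub_finite_set _ _ ((fun i : nat => i%:R / N%:R : R) @` `I_N.+1)).
  by move=> _ [i /andP[_ iN] ->]; exists i.
by apply: finite_image; exact: finite_II.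
Qed.

(** Change of variables for push-forwards; boundedness of [g] supplies the integrability that it
    requires. *)
Lemma Rintegral_bpush (R : realType) (T U : ptopologicalType) (f : T -> U)
    (mf : measurable_fun [set: borel T] (f : borel T -> borel U))
    (mu : bprob R T) (g : U -> R) :
  continuous g -> bounded_fun g ->
  \int[bpush mf mu]_y g y = \int[mu]_x g (f x).
Proof.
move=> cg bg; rewrite /Rintegral; congr fine.
have mg : measurable_fun [set: borel U] (EFin \o g).
  by apply/measurable_EFinP; exact: continuous_borel_real.
apply: (@integral_pushforward _ _ (borel T) (borel U) R f mf mu setT
  (EFin \o g)) => //.
rewrite preimage_setT; apply: measurable_bounded_integrable => //.
- by rewrite (le_lt_trans (probability_le1 _ _)) ?ltry.
- apply: (@measurableT_comp _ _ _ (borel T) (borel U) R g) mf.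
  exact/measurable_EFinP.
- case: bg => M [Mr bg]; exists M; split => // y /bg h x _; exact: h.
Qed.

(** * Continuity of the attention dynamics and of the push-forward map *)

Section dynamics.
Variables (R : realType) (N d d1 d2 : nat) (beta : R) (N0 : (0 < N)%N).
Variables (S : set 'cV[R]_d) (S0 : S !=set0).
Hypothesis cS : compact S.

Local Notation ptS := (@pt _ S S0).

Lemma compact_state : compact [set: state N0 S0].
Proof.
rewrite -setXTT; apply: compact_setX; apply: compact_nonempty_type => //.
exact: compact_PE.
Qed.

Lemma continuous_marginal : continuous (@marginal R N d N0 S S0).
Proof.
apply: continuous_bprob => f cf bf.
(* Testing the marginal against [f] amounts to testing [mu] against [f] composed with the second
   projection. *)
rewrite [X in continuous X](_ : _ =
  fun mu : bprob R (state N0 S0) => \int[mu]_x f x.2).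
  apply: integral_continuous_test.
    exact: continuous_compose (@continuous_snd _ _) cf.
  by case: bf => M [Mr bf]; exists M; split => // y /bf h x _; exact: h.
by apply/funext => mu; rewrite /marginal Rintegral_bpush.
Qed.

(** By compactness the exponential weight attains a positive minimum, and the integral against a
    probability measure is at least that minimum. *)
Lemma weight_integral_gt0 (Q Ky : 'M[R]_(d2, d))
    (nu : bprob R (nonempty_type S0)) (x : 'cV[R]_d) :
  0 < \int[nu]_z weight beta Q Ky x (ptS z).
Proof.
have cw : continuous (fun z : nonempty_type S0 => weight beta Q Ky x (ptS z)).
  apply: continuous_weight; [exact: cst_continuous..|exact: pt_continuous].
have cT := @compact_nonempty_type _ _ S0 cS.
have T0 : [set: nonempty_type S0] !=set0 by exists point.
have [c _ cmin] := compact_EVT_min T0 cT (continuous_subspaceT cw).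
have bw := compact_continuous_bounded cT cw.
apply: (@lt_le_trans _ _ (weight beta Q Ky x (ptS c))); first exact: expR_gt0.
rewrite -[leLHS](Rintegral_probability_cst nu).
apply: le_Rintegral => //.
- exact: (finite_measure_integrable_cst nu (weight beta Q Ky x (ptS c))).
- exact: bounded_continuous_integrable.
- by move=> z _; apply: cmin; rewrite inE.
Qed.

Section parametrized.
Variable Z : topologicalType.

Lemma continuous_attention (Q Ky : Z -> 'M[R]_(d2, d)) (V : Z -> 'M[R]_d)
    (nu : Z -> bprob R (nonempty_type S0)) (x : Z -> 'cV[R]_d) :
  continuous Q -> continuous Ky -> continuous V -> continuous nu ->
  continuous x ->
  continuous (fun z => attention beta (Q z) (Ky z) (V z) (nu z) (x z)).
Proof.
move=> cQ cK cV cnu cx; apply: continuous_matrix => i j.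
rewrite [X in continuous X](_ : _ = fun z =>
  (\int[nu z]_y weight beta (Q z) (Ky z) (x z) (ptS y))^-1 *
  \int[nu z]_y (weight beta (Q z) (Ky z) (x z) (ptS y) * (V z *m ptS y) i 0));
  last by apply/funext => z; rewrite !mxE.
(* Both integrands must be jointly continuous in the parameter and the integration variable, hence
   on this product. *)
pose ZT := (Z * nonempty_type S0)%type.
have lift (T : topologicalType) (f : Z -> T) : continuous f ->
    continuous (fun zy : ZT => f zy.1).
  by move=> cf; exact: continuous_compose (@continuous_fst _ _) cf.
have cpt : continuous (fun zy : ZT => ptS zy.2).
  by apply: continuous_compose (@continuous_snd _ _) _; exact: pt_continuous.
have cw : continuous (fun zy : ZT =>
    weight beta (Q zy.1) (Ky zy.1) (x zy.1) (ptS zy.2)).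
  by apply: continuous_weight => //; exact: lift.
apply: continuousMr.
  move=> z; apply: cvgV; first by rewrite gt_eqF// weight_integral_gt0.
  exact: (continuous_Rintegral (compact_nonempty_type cS) cnu cw).
apply: (continuous_Rintegral (compact_nonempty_type cS) cnu (h := fun z y =>
  weight beta (Q z) (Ky z) (x z) (ptS y) * (V z *m ptS y) i 0)).
apply: continuousMr => //; apply: continuous_entry.
by apply: continuous_mulmx => //; exact: lift.
Qed.

Variable sigma : 'cV[R]_d1 -> 'cV[R]_d1.
Hypothesis sigmaL : lipschitz1 sigma.

Lemma continuous_step (U : Z -> action R d d1 d2)
    (nu : Z -> bprob R (nonempty_type S0)) (x : Z -> 'cV[R]_d) :
  continuous U -> continuous nu -> continuous x ->
  continuous (fun z => step beta sigma (U z) (nu z) (x z)).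
Proof.
move=> cU cnu cx.
(* An action is a left-nested tuple: [c1] to [c5] peel off its first projections one by one, and a
   second projection of each gives the remaining components. *)
have c1 := continuous_compose cU (@continuous_fst _ _).
have c2 := continuous_compose c1 (@continuous_fst _ _).
have c3 := continuous_compose c2 (@continuous_fst _ _).
have c4 := continuous_compose c3 (@continuous_fst _ _).
have c5 := continuous_compose c4 (@continuous_fst _ _).
rewrite [X in continuous X](_ : _ = fun z =>
  (U z).1.1.1.1.1 *m sigma ((U z).1.1.1.1.2 *m x z + (U z).1.1.1.2) +
  attention beta (U z).1.1.2 (U z).1.2 (U z).2 (nu z) (x z)); last first.
  by apply/funext => z; case: (U z) => [[[[[W A] b] Q] Ky] V].
apply: continuous_addmx.
  apply: continuous_mulmx => //.
  apply: continuous_compose (lipschitz1_continuous sigmaL).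
  apply: continuous_addmx.
    apply: continuous_mulmx => //.
    exact: continuous_compose c4 (@continuous_snd _ _).
  exact: (continuous_compose c3 (@continuous_snd _ _)).
apply: continuous_attention => //.
- exact: continuous_compose c2 (@continuous_snd _ _).
- exact: continuous_compose c1 (@continuous_snd _ _).
- exact: continuous_compose cU (@continuous_snd _ _).
Qed.

Variables (UU : set (action R d d1 d2)) (UU0 : UU !=set0).
Hypothesis sv : state_valued beta N0 S0 UU0 sigma.

Lemma continuous_transition (x : Z -> state N0 S0) (U : Z -> nonempty_type UU0)
    (mu : Z -> bprob R (state N0 S0)) :
  continuous x -> continuous U -> continuous mu ->
  continuous (fun z => transition sv (x z) (U z) (mu z)).
Proof.
move=> cx cU cmu; apply: continuous_pair.
  exact: continuous_compose cx (@continuous_fst _ _).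
apply: continuous_mk_pt; apply: continuous_step.
- apply: continuous_compose cU _; exact: pt_continuous.
- exact: continuous_compose cmu continuous_marginal.
- apply: continuous_compose (continuous_compose cx (@continuous_snd _ _)) _.
  exact: pt_continuous.
Qed.
End parametrized.

Variable sigma : 'cV[R]_d1 -> 'cV[R]_d1.
Hypothesis sigmaL : lipschitz1 sigma.
Variables (UU : set (action R d d1 d2)) (UU0 : UU !=set0).
Hypothesis sv : state_valued beta N0 S0 UU0 sigma.

Lemma continuous_Phi (Z : topologicalType) (mu : Z -> bprob R (state N0 S0))
    (U : Z -> nonempty_type UU0) :
  continuous mu -> continuous U ->
  continuous (fun z => Phi sv sigmaL (mu z) (U z)).
Proof.
move=> cmu cU; apply: continuous_bprob => g cg bg.
(* After the change of variables [mu z] occurs twice, as the integrating measure and inside the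
   transition map. Joint continuity of the integrand in [z] and [x] handles both dependences at
   once. *)
rewrite [X in continuous X](_ : _ = fun z =>
  \int[mu z]_x g (transition sv x (U z) (mu z))).
  apply: (continuous_Rintegral compact_state cmu
    (h := fun z x => g (transition sv x (U z) (mu z)))).
  apply: continuous_compose cg; apply: continuous_transition => //.
  - exact: continuous_snd.
  - exact: continuous_compose (@continuous_fst _ _) cU.
  - exact: continuous_compose (@continuous_fst _ _) cmu.
by apply/funext => z; rewrite /Phi Rintegral_bpush.
Qed.

Lemma continuous_bPhi K :
  continuous (@bPhi _ _ _ _ _ _ _ _ _ _ _ sigma sv sigmaL K).
Proof.
apply: (@prod_topology_continuous _ _
  (fun _ : 'I_K => bprob R (state N0 S0) : topologicalType)) => k.
apply: (@continuous_Phi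
  (power K (bprob R (state N0 S0)) * nonempty_type UU0)%type
  (fun muU => muU.1 k) (@snd _ _)); last exact: continuous_snd.
apply: (@continuous_compose _ (power K (bprob R (state N0 S0))) _ fst
  (fun mu => mu k)); first exact: continuous_fst.
exact: (@prod_topology_proj_continuous _
  (fun _ : 'I_K => bprob R (state N0 S0) : topologicalType)).
Qed.
End dynamics.

Theorem corollary4 (R : realType) (N K d d1 d2 : nat) (beta : R)
    (N_gt0 : (0 < N)%N) (K_gt0 : (0 < K)%N)
    (d_gt0 : (0 < d)%N) (d1_gt0 : (0 < d1)%N) (d2_gt0 : (0 < d2)%N)
    (beta_gt0 : 0 < beta)
    (S : set 'cV[R]_d) (S_neq0 : S !=set0)
    (sigma : 'cV[R]_d1 -> 'cV[R]_d1) (sigma_lip : lipschitz1 sigma)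
    (UU : set (action R d d1 d2)) (UU_neq0 : UU !=set0)
    (f_valued : state_valued beta N_gt0 S_neq0 UU_neq0 sigma)
    (S_compact : compact S) (UU_compact : compact UU) :
  exists mbPhi, weak_feller (eta_kernel f_valued sigma_lip K mbPhi).
Proof.
have cPhi : continuous (bPhi f_valued sigma_lip (K := K)).
  exact: (@continuous_bPhi _ _ _ _ _ _ _ _ S_neq0 S_compact).
(* Continuity also yields the Borel measurability that makes the Dirac masses a kernel. *)
exists (continuous_borel cPhi) => g cg bg.
rewrite [X in continuous X](_ : _ = fun z => g (bPhi f_valued sigma_lip z)).
  exact: continuous_compose cPhi cg.
apply/funext => z; rewrite /Rintegral /= integral_dirac//.
  by rewrite diracT mul1e.
by apply/measurable_EFinP; exact: continuous_borel_real.
Qed.
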